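(* Let $\widehat{\mathcal{A}}_k(\tau)$ and $\mathcal{L}_k(\tau)$ be the weight $2k$ quasimodular forms attached to the $\widehat{A}$-genus and to Hirzebruch's $L$-genus, as defined in the context. For a partition $\lambda=(1^{m_1},2^{m_2},\dots,k^{m_k})\vdash k$ put $$\phi_{\widehat A}(\lambda)=\prod_{j=1}^k\frac{1}{m_j!}\left(\frac{-1}{(2j)!}\right)^{m_j},\qquad \phi_L(\lambda)=\prod_{j=1}^k\frac{1}{m_j!}\left(\frac{4^j(4^j-2)}{(2j)!}\right)^{m_j},$$ and for a function $\phi$ on partitions put $\operatorname{Tr}_k(\phi;\tau)=\sum_{\lambda\vdash k}\phi(\lambda)G_\lambda(\tau)$. If $k$ is a positive integer, then as Fourier series (in $q=e^{2\pi i\tau}$) $$\widehat{\mathcal{A}}_k(\tau)=\operatorname{Tr}_k(\phi_{\widehat A};\tau)\qquad\text{and}\qquad \mathcal{L}_k(\tau)=\operatorname{Tr}_k(\phi_L;\tau).$$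
   Context: Eisenstein series: for $k\ge1$ and $\operatorname{Im}(\tau)>0$, $G_{2k}(\tau)=-\frac{B_{2k}}{2k}+2\sum_{n\ge1}\sigma_{2k-1}(n)q^n$, where $q=e^{2\pi i\tau}$, $B_{2k}$ is the $2k$-th Bernoulli number and $\sigma_\nu(n)=\sum_{d\mid n}d^\nu$. Partitions: $\lambda=(1^{m_1},\dots,k^{m_k})\vdash k$ means that $m_j\ge0$ is the multiplicity of the part $j$ and $\sum_j jm_j=k$. The partition Eisenstein series is $G_\lambda(\tau)=G_2(\tau)^{m_1}G_4(\tau)^{m_2}\cdots G_{2k}(\tau)^{m_k}$. Genera: let $x_1,x_2,\dots$ be indeterminates, $p_k=\sum_{i_1<\cdots<i_k}x_{i_1}\cdots x_{i_k}$ the elementary symmetric functions and $s_j=\sum_i x_i^j$ the power sums. Let $$\widehat{A}(p_1,p_2,\dots;t)=\prod_{i\ge1}Q_{\widehat A}(x_it),\quad Q_{\widehat A}(z)=\frac{\frac12\sqrt z}{\sinh(\frac12\sqrt z)},\qquad L(p_1,p_2,\dots;t)=\prod_{i\ge1}Q_L(x_it),\quad Q_L(z)=\frac{\sqrt z}{\tanh\sqrt z},$$ regarded as formal power series in $t$ whose coefficients are symmetric functions ($Q_{\widehat A}$ and $Q_L$ are power series in $z$ with constant term $1$). Quasimodular avatars: let $F$ be one of these two series and write $F=1+\sum_{k\ge1}b_k(F;p_1,p_2,\dots)t^k$. Each $b_k$ is a polynomial in the $p_i$, homogeneous of weighted degree $k$ (with $p_i$ of weight $i$), and can be written uniquely in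 power sums as $b_k=\sum_{\lambda\vdash k}\beta_F(\lambda)s_\lambda$, where $s_\lambda=s_1^{m_1}s_2^{m_2}\cdots s_k^{m_k}$. Set $$\beta_F^\star(\lambda)=\beta_F(\lambda)\prod_{j=1}^k\left(\frac{2j}{B_{2j}}\right)^{m_j},\qquad \mathcal{F}_k(\tau)=\sum_{\lambda\vdash k}\beta_F^\star(\lambda)G_\lambda(\tau).$$ Then $\widehat{\mathcal{A}}_k(\tau)$ denotes $\mathcal{F}_k(\tau)$ for $F=\widehat{A}(p_1,p_2,\dots;t)$, and $\mathcal{L}_k(\tau)$ denotes $\mathcal{F}_k(\tau)$ for $F=L(p_1,p_2,\dots;t)$. *)

(* Defs.v *)
From HB Require Import structures.
From mathcomp Require Import all_boot all_order all_algebra.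
From mathcomp Require Import complex.
From mathcomp Require Import all_classical all_reals all_analysis.
From mathcomp Require mpoly.
(* The notations of mpoly clash with those of mathcomp-analysis. *)
Import -(notations) mpoly.

Set Implicit Arguments.
Unset Strict Implicit.
Unset Printing Implicit Defensive.

Import Order.TTheory GRing.Theory Num.Theory numFieldNormedType.Exports.
Local Open Scope ring_scope.

(* [f : fps R] is the series \sum_n (f n) t^n.  The alias keeps the Cauchy
   product apart from the pointwise product that [nat -> R] already carries. *)
Definition fps (R : Type) := nat -> R.

HB.instance Definition _ (R : comNzRingType) :=
  GRing.Zmodule.copy (fps R) (nat -> R).

Section FpsRing.
Variable R : comNzRingType.
Implicit Types f g h : fps R.

Definition fps_one : fps R := fun n => (n == 0%N)%:R.

Definition fps_mul f g : fps R := fun n => \sum_(i < n.+1) f i * g (n - i)%N.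

(* Up to degree n, a series multiplies like its truncation in {poly R}. *)
Let trunc n f : {poly R} := \poly_(i < n.+1) f i.

Let coef_trunc n f i : (i <= n)%N -> (trunc n f)`_i = f i.
Proof. by move=> le_in; rewrite coef_poly ltnS le_in. Qed.

Let fps_mul_trunc n f g i :
  (i <= n)%N -> fps_mul f g i = (trunc n f * trunc n g)`_i.
Proof.
move=> le_in; rewrite coefM; apply: eq_bigr => j _.
have le_ji : (j <= i)%N by rewrite -ltnS.
by rewrite !coef_trunc ?(leq_trans le_ji) ?(leq_trans (leq_subr _ _)).
Qed.

Let fps_mulC : commutative fps_mul.
Proof. by move=> f g; apply/funext => n; rewrite !(fps_mul_trunc _ _ (leqnn n)) mulrC. Qed.

Let fps_mulA : associative fps_mul.
Proof.
move=> f g h; apply/funext => n.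
have eq_prod (p : {poly R}) (u v w : fps R) :
    (forall i, (i <= n)%N -> fps_mul u v i = p`_i) ->
  fps_mul (fps_mul u v) w n = (p * trunc n w)`_n.
  move=> eq_p; rewrite coefM; apply: eq_bigr => i _.
  by rewrite eq_p ?coef_trunc ?leq_subr // -ltnS.
rewrite (fps_mulC f).
rewrite (eq_prod _ _ _ _ (fun i => @fps_mul_trunc n g h i)).
rewrite (eq_prod _ _ _ _ (fun i => @fps_mul_trunc n f g i)).
by rewrite mulrC mulrA.
Qed.

Let fps_mul1 : left_id fps_one fps_mul.
Proof.
move=> f; apply/funext => n; rewrite /fps_mul big_ord_recl /= mul1r subn0.
by rewrite big1 ?addr0 // => i _; rewrite mul0r.
Qed.

Let fps_mulDl : left_distributive fps_mul +%R.
Proof.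
move=> f g h; apply/funext => n; rewrite /fps_mul [RHS]/GRing.add /=.
by rewrite -big_split /=; apply: eq_bigr => i _; rewrite -mulrDl.
Qed.

Let fps_one_neq0 : fps_one != 0.
Proof. by apply/eqP => /(congr1 (@^~ 0%N)) /eqP; rewrite oner_eq0. Qed.

HB.instance Definition _ := GRing.Zmodule_isComNzRing.Build (fps R)
  fps_mulA fps_mulC fps_mul1 fps_mulDl fps_one_neq0.

Lemma fps_mulE f g n : (f * g) n = \sum_(i < n.+1) f i * g (n - i)%N.
Proof. by []. Qed.

Lemma fps_oneE n : (1 : fps R) n = (n == 0%N)%:R.
Proof. by []. Qed.

End FpsRing.

Section FpsUnitRing.
Variable R : comUnitRingType.
Implicit Types f g : fps R.

(* First n coefficients of 1 / f. *)
Fixpoint fps_inv_seq f (n : nat) : seq R :=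
  if n is m.+1 then
    let s := fps_inv_seq f m in
    rcons s ((f 0%N)^-1 * ((m == 0%N)%:R - \sum_(i < m) s`_i * f (m - i)%N))
  else [::].

Definition fps_unit : pred (fps R) := fun f => f 0%N \is a GRing.unit.

Definition fps_inv f : fps R :=
  if fps_unit f then fun n => (fps_inv_seq f n.+1)`_n else f.

Let size_fps_inv_seq f n : size (fps_inv_seq f n) = n.
Proof. by elim: n => //= n IHn; rewrite size_rcons IHn. Qed.

Let nth_fps_inv_seq f n i :
  (i < n)%N -> (fps_inv_seq f n)`_i = (fps_inv_seq f i.+1)`_i.
Proof.
elim: n => // n IHn; rewrite ltnS leq_eqVlt => /orP[/eqP-> //|lt_in].
by rewrite [LHS]/= nth_rcons size_fps_inv_seq lt_in IHn.
Qed.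

Let fps_mulVf : {in fps_unit, left_inverse 1 fps_inv *%R}.
Proof.
move=> f Uf; rewrite /fps_inv ifT //; apply/funext => n.
rewrite fps_mulE fps_oneE big_ord_recr /= subnn.
rewrite nth_rcons size_fps_inv_seq ltnn eqxx mulrAC mulVr // mul1r.
rewrite addrC -[RHS](subrK (\sum_(i < n) (fps_inv_seq f n)`_i * f (n - i)%N)).
by congr (_ + _); apply: eq_bigr => i _; rewrite [in RHS]nth_fps_inv_seq.
Qed.

Let fps_unitPl f g : g * f = 1 -> fps_unit f.
Proof.
move=> /(congr1 (@^~ 0%N)); rewrite fps_mulE fps_oneE big_ord1 /= => gf1.
by apply/unitrPr; exists (g 0%N); rewrite mulrC.
Qed.

Let fps_inv_out : {in [predC fps_unit], fps_inv =1 id}.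
Proof. by move=> f nUf; rewrite /fps_inv ifN. Qed.

HB.instance Definition _ := GRing.ComNzRing_hasMulInverse.Build (fps R)
  fps_mulVf fps_unitPl fps_inv_out.

End FpsUnitRing.

(* t / (e^t - 1) = \sum_n B_n t^n / n!, where (e^t - 1) / t is the series
   \sum_n t^n / (n+1)!. *)
Definition bernoulli (n : nat) : rat :=
  n`!%:R * ((fun i => (i.+1)`!%:R^-1) : fps rat)^-1 n.

Definition sigma (nu n : nat) : nat := (\sum_(d <- divisors n) d ^ nu)%N.

(* The Fourier series of G_{2j}, as a formal power series in q. *)
Definition eisenstein_fourier (j : nat) : fps rat :=
  fun n => if n == 0%N then - bernoulli (2 * j) / (2 * j)%:R
           else 2 * (sigma (2 * j).-1 n)%:R.

Section Eisenstein.
Local Open Scope complex_scope.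
Variable R : realType.

Definition cexp (z : R[i]) : R[i] :=
  (expR (complex.Re z))%:C *
  (cos (complex.Im z) +i* sin (complex.Im z)).

Definition nome (tau : R[i]) : R[i] := cexp (2 * pi%:C * 'i%C * tau).

(* G_{2j}(tau); the series converges when Im tau > 0.  The regular module
   [R[i]^o] is where MathComp-Analysis puts the topology of R[i]. *)
Definition eisenstein (tau : R[i]) (j : nat) : R[i] :=
  ratr (- bernoulli (2 * j) / (2 * j)%:R) +
  2 * limn (fun N => \sum_(1 <= n < N)
                        (sigma (2 * j).-1 n)%:R * nome tau ^+ n : R[i]^o).

End Eisenstein.

(* A partition (1^{m_1}, ..., k^{m_k}) of k, given by its multiplicities: the
   index j : 'I_k stands for the part j.+1, and m_j <= k always holds. *)
Definition mpart (k : nat) :=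
  {m : {ffun 'I_k -> 'I_k.+1} | (\sum_(j < k) j.+1 * m j)%N == k}.

Definition mult (k : nat) (l : mpart k) (j : 'I_k) : nat := val l j.

(* g_1^{m_1} ... g_k^{m_k}; it is used for s_lambda (g_j = s_j) and for
   G_lambda (g_j = G_{2j}). *)
Definition partition_monomial (A : comNzRingType) (g : nat -> A) (k : nat)
    (l : mpart k) : A :=
  \prod_(j < k) g j.+1 ^+ mult l j.

(* Tr_k(phi) for the Eisenstein series g_j = G_{2j}, either as complex numbers
   (at a given tau) or as Fourier series; in [fps rat], [ratr c] is the
   constant series c. *)
Definition partition_trace (A : comUnitRingType) (g : nat -> A) (k : nat)
    (phi : mpart k -> rat) : A :=
  \sum_(l : mpart k) ratr (phi l) * partition_monomial g l.

(* Symmetric functions in x_1, x_2, ... are represented by their restrictions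
   to n variables (x_i = 0 for i > n), for all n. *)
Definition power_sum (n j : nat) : mpoly n rat :=
  \sum_(i < n) mpolyX rat (mnm1 i) ^+ j.

(* \prod_i Q(x_i t), as a power series in t over Q[x_1, ..., x_n]. *)
Definition genus (Q : fps rat) (n : nat) : fps (mpoly n rat) :=
  \prod_(i < n) ((fun j => Q j *: mpolyX rat (mnm1 i) ^+ j) : fps (mpoly n rat)).

(* The coefficients beta_F(lambda) of b_k = \sum_lambda beta_F(lambda) s_lambda
   in the ring of symmetric functions.  They are unique since power sums are
   algebraically independent over rat, and exist as soon as Q 0 = 1. *)
Definition genus_coef (Q : fps rat) (k : nat) : {ffun mpart k -> rat} :=
  xget 0 [set beta : {ffun mpart k -> rat} | forall n : nat,
    genus Q n k =
    \sum_(l : mpart k) beta l *: partition_monomial (power_sum n) l]%classic.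

Definition genus_coef_star (Q : fps rat) (k : nat) (l : mpart k) : rat :=
  genus_coef Q k l *
  \prod_(j < k) ((2 * j.+1)%:R / bernoulli (2 * j.+1)) ^+ mult l j.

Definition avatar (Q : fps rat) (A : comUnitRingType) (g : nat -> A)
    (k : nat) : A :=
  \sum_(l : mpart k) ratr (genus_coef_star Q l) * partition_monomial g l.

(* sinh(sqrt z) / sqrt z, cosh(sqrt z), and sinh(sqrt z / 2) / (sqrt z / 2). *)
Definition sinhc_sqrt : fps rat := fun n => (2 * n).+1`!%:R^-1.
Definition cosh_sqrt : fps rat := fun n => (2 * n)`!%:R^-1.
Definition sinhc_half_sqrt : fps rat := fun n => 4^-1 ^+ n * sinhc_sqrt n.

Definition Q_Ahat : fps rat := sinhc_half_sqrt^-1.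
Definition Q_L : fps rat := cosh_sqrt / sinhc_sqrt.

Definition phi_Ahat (k : nat) (l : mpart k) : rat :=
  \prod_(j < k) ((mult l j)`!%:R^-1 *
                 (- 1 / (2 * j.+1)`!%:R) ^+ mult l j).

Definition phi_L (k : nat) (l : mpart k) : rat :=
  \prod_(j < k) ((mult l j)`!%:R^-1 *
                 (4 ^+ j.+1 * (4 ^+ j.+1 - 2) / (2 * j.+1)`!%:R) ^+ mult l j).

(* Main.v *)
Require Import Defs.
From mathcomp Require Import all_boot all_order all_algebra.
From mathcomp Require Import complex.
From mathcomp Require Import all_classical all_reals all_analysis.
From mathcomp Require Import ring lra zify.
From mathcomp Require mpoly.
Import -(notations) mpoly.

Import Order.TTheory GRing.Theory Num.Theory.
Local Open Scope ring_scope.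

Set Implicit Arguments.
Unset Strict Implicit.
Unset Printing Implicit Defensive.

(** Both equalities hold for any values of the Eisenstein series, because the
    two sides have the same coefficients: the theorem is the identity
    [genus_coef_star Q lam = phi lam] between functions on partitions.

    Write [theta] for the derivation [z d/dz] and let [l = theta Q / Q].  Then
    [log Q = \sum_(j >= 1) (l_j / j) z^j], so that
    [\prod_i Q (x_i t) = exp (\sum_j (l_j / j) s_j t^j)], and expanding the
    product of the exponentials gives
    [beta_F (lam) = \prod_j (l_j / j) ^ m_j / m_j!] ([genus_expansion]).  No
    logarithm of a series has to be formed: both sides have constant term 1 and
    the same logarithmic derivative, which determines a series in
    characteristic 0 ([fps_theta_unique]).  That these are _the_ coefficients is
    the linear independence of the [s_lam] ([power_sum_partitions_free]).

    It remains to compute [l] for the two characteristic series.  Everything is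
    governed by [V (z) = sqrt z coth (sqrt z)], which solves the Riccati equation
    [2 theta V = V - V ^ 2 + z].  Such an equation together with the constant
    term 1 has a single solution ([riccati_unique]), and this replaces all
    identities between hyperbolic functions:
    - the substitution [z = t ^ 2 / 4] turns it into the equation of
      [t / (e ^ t - 1) + t / 2], hence [V_j / 4 ^ j = B_(2j) / (2j)!]
      ([bernoulli_cothc]);
    - for the A-hat genus, [2 l = 1 - V (z / 4)] ([Q_Ahat_theta]);
    - for the L-genus, [Q = V] and [2 l = 1 - V + z / V]; the sum [V + z / V] solves
      the equation of [V (4 z)], which is the duplication formula
      [coth x + tanh x = 2 coth (2 x)], hence [2 l = 1 - 2 V + V (4 z)]
      ([Q_L_theta]).

    Since the normalisation in [genus_coef_star] divides by [B_(2j)], these numbers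
    must not vanish; the Riccati equation also shows that the [V_j] alternate in
    sign ([cothc_sqrt_neq0]). *)

(** * Formal power series *)

Section FpsCoefficients.
Variable A : comNzRingType.
Implicit Types f g h : fps A.

Lemma fps_ext f g : (forall n, f n = g n) -> f = g.
Proof. by move=> fg; apply/funext. Qed.

Lemma fps_addE f g n : (f + g) n = f n + g n.
Proof. by []. Qed.

Lemma fps_oppE f n : (- f) n = - f n.
Proof. by []. Qed.

Lemma fps_mulrnE f m n : (f *+ m) n = f n *+ m.
Proof. by elim: m => // m IHm; rewrite !mulrS fps_addE IHm. Qed.

Lemma fps_sumE (I : Type) (r : seq I) (P : pred I) (F : I -> fps A) n :
  (\sum_(i <- r | P i) F i) n = \sum_(i <- r | P i) F i n.
Proof. exact: (big_morph (fun f : fps A => f n)). Qed.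

Lemma fps_mulE0 f g : (f * g) 0%N = f 0%N * g 0%N.
Proof. by rewrite fps_mulE big_ord1 subn0. Qed.

Lemma fps_prodE0 (I : Type) (r : seq I) (P : pred I) (F : I -> fps A) :
  (\prod_(i <- r | P i) F i) 0%N = \prod_(i <- r | P i) F i 0%N.
Proof. exact: (big_morph (fun f : fps A => f 0%N) fps_mulE0). Qed.

Definition fps_monom (d : nat) (a : A) : fps A :=
  fun n => if n == d then a else 0.

Lemma fps_monomM d a f n :
  (fps_monom d a * f) n = if (d <= n)%N then a * f (n - d)%N else 0.
Proof.
rewrite fps_mulE; case: leqP => [le_dn | lt_nd].
  have lt_dn : (d < n.+1)%N by [].
  rewrite (bigD1 (Ordinal lt_dn)) //= {1}/fps_monom eqxx big1 ?addr0 //.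
  by move=> i; rewrite -val_eqE /fps_monom /= => /negPf->; rewrite mul0r.
apply: big1 => i _; rewrite /fps_monom; case: eqP => [eq_id|]; last by rewrite mul0r.
by have := ltn_ord i; rewrite eq_id ltnS leqNgt lt_nd.
Qed.

Lemma fps_monom_mul d a e b :
  fps_monom d a * fps_monom e b = fps_monom (d + e) (a * b).
Proof.
apply: fps_ext => n; rewrite fps_monomM /fps_monom.
case: leqP => [le_dn|lt_nd].
  by rewrite -(eqn_add2l d) subnKC //; case: eqP; rewrite ?mulr0.
by case: eqP => // eq_n; rewrite eq_n ltnNge leq_addr in lt_nd.
Qed.

Lemma fps_monom_prod (I : finType) (d : I -> nat) (a : I -> A) :
  \prod_i fps_monom (d i) (a i) = fps_monom (\sum_i d i) (\prod_i a i).
Proof.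
apply: (big_rec3 (fun f e b => f = fps_monom e b)) => [|i b e f _ ->].
  by apply: fps_ext => n; rewrite fps_oneE /fps_monom; case: eqP.
exact: fps_monom_mul.
Qed.

(** The Euler derivation z d/dz: unlike d/dz it keeps degrees, so that no index
    is shifted in the differential equations below. *)
Definition fps_theta f : fps A := fun n => f n *+ n.

Lemma fps_thetaM f g : fps_theta (f * g) = fps_theta f * g + f * fps_theta g.
Proof.
apply: fps_ext => n; rewrite /fps_theta fps_addE !fps_mulE -sumrMnl -big_split.
apply: eq_bigr => i _ /=; rewrite mulrnAl mulrnAr -mulrnDr subnKC //.
by rewrite -ltnS.
Qed.

Lemma fps_thetaD f g : fps_theta (f + g) = fps_theta f + fps_theta g.
Proof. by apply: fps_ext => n; rewrite /fps_theta !fps_addE mulrnDl. Qed.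

Lemma fps_thetaN f : fps_theta (- f) = - fps_theta f.
Proof. by apply: fps_ext => n; rewrite /fps_theta !fps_oppE mulNrn. Qed.

Lemma fps_theta1 : fps_theta 1 = 0.
Proof. by apply: fps_ext => -[|n] //; rewrite /fps_theta fps_oneE mul0rn. Qed.

Lemma fps_theta_prod (I : Type) (r : seq I) (F L : I -> fps A) :
  (forall i, fps_theta (F i) = F i * L i) ->
  fps_theta (\prod_(i <- r) F i) = (\prod_(i <- r) F i) * \sum_(i <- r) L i.
Proof.
move=> dF; elim: r => [|i r IHr]; first by rewrite !big_nil fps_theta1 mulr0.
by rewrite !big_cons fps_thetaM dF IHr; ring.
Qed.

(** Congruence modulo [t^(k+1)]. *)
Definition fps_agree (k : nat) f g := forall n, (n <= k)%N -> f n = g n.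

Lemma fps_agree_prod k (I : finType) (F G : I -> fps A) :
  (forall i, fps_agree k (F i) (G i)) -> fps_agree k (\prod_i F i) (\prod_i G i).
Proof.
move=> FG; apply: (big_ind2 (fps_agree k)) => // f f' g g' ff' gg' n le_nk.
rewrite !fps_mulE; apply: eq_bigr => i _.
have le_ik : (i <= k)%N by rewrite (leq_trans _ le_nk) // -ltnS.
by rewrite ff' // gg' // (leq_trans (leq_subr _ _)).
Qed.

End FpsCoefficients.

Section FpsDilation.
Variables (R A : comNzRingType) (iota : {rmorphism R -> A}).

(** The substitution [f (x z)], with a change of coefficient ring along [iota]. *)
Definition fps_dilate (x : A) (f : fps R) : fps A := fun n => iota (f n) * x ^+ n.

Lemma fps_dilateM x f g : fps_dilate x (f * g) = fps_dilate x f * fps_dilate x g.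
Proof.
apply: fps_ext => n; rewrite /fps_dilate !fps_mulE rmorph_sum mulr_suml.
apply: eq_bigr => i _; rewrite rmorphM mulrACA -exprD subnKC //.
by rewrite -ltnS.
Qed.

Lemma fps_dilateD x f g : fps_dilate x (f + g) = fps_dilate x f + fps_dilate x g.
Proof. by apply: fps_ext => n; rewrite /fps_dilate !fps_addE rmorphD mulrDl. Qed.

Lemma fps_dilateN x f : fps_dilate x (- f) = - fps_dilate x f.
Proof. by apply: fps_ext => n; rewrite /fps_dilate !fps_oppE rmorphN mulNr. Qed.

Lemma fps_dilate_theta x f : fps_theta (fps_dilate x f) = fps_dilate x (fps_theta f).
Proof. by apply: fps_ext => n; rewrite /fps_theta /fps_dilate rmorphMn mulrnAl. Qed.

End FpsDilation.

(** * A Riccati equation *)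

Section Riccati.
Variable A : numDomainType.
Implicit Types a f g : fps A.

(** The factor [m] accommodates the square root in the variable: with [z = t ^ 2],
    the derivation [t d/dt] is [2 z d/dz]. *)
Definition riccati (m : nat) a f : Prop :=
  f 0%N = 1 /\ fps_theta f *+ m = f - f * f + a.

(** The difference [h] of two solutions satisfies the linear equation
    [m theta h = h - h (f + g)].  As [f + g] has constant term 2, the lowest
    nonzero coefficient of [h], in degree [n], would satisfy [(m n + 1) h_n = 0]. *)
Lemma riccati_unique m a f g : riccati m a f -> riccati m a g -> f = g.
Proof.
move=> [f0 df] [g0 dg]; apply/eqP; rewrite -subr_eq0; apply/eqP.
apply: fps_ext => n.
have dh : fps_theta (f - g) *+ m = (f - g) - (f - g) * (f + g).
  by rewrite fps_thetaD fps_thetaN mulrnDl mulNrn df dg; ring.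
elim/ltn_ind: n => -[|n] IHn; first by rewrite fps_addE fps_oppE f0 g0 subrr.
move/(congr1 (fun u : fps A => u n.+1)): dh.
rewrite fps_mulrnE [in RHS]fps_addE fps_oppE fps_mulE big_ord_recr /= big1; last first.
  by move=> i _; rewrite IHn ?mul0r.
rewrite add0r subnn [(f + g) 0%N]fps_addE f0 g0 /fps_theta -mulrnA => eq_h.
have /eqP: (f - g) n.+1 *+ (n.+1 * m).+1 = 0 by rewrite mulrS eq_h; ring.
by rewrite mulrn_eq0 => /eqP.
Qed.

Lemma riccati_dilate m a f (x : A) :
  riccati m a f -> riccati m (fps_dilate idfun x a) (fps_dilate idfun x f).
Proof.
move=> [f0 df]; split; first by rewrite /fps_dilate f0 /= mulr1.
rewrite fps_dilate_theta -fps_dilateM -fps_dilateN -!fps_dilateD -df.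
by apply: fps_ext => n; rewrite fps_mulrnE /fps_dilate /= fps_mulrnE /fps_theta !mulrnAl.
Qed.

End Riccati.

(** * The series sqrt z coth (sqrt z) *)

Lemma fps_mulVr (f : fps rat) : f 0%N = 1 -> f^-1 * f = 1.
Proof. by move=> f0; apply: mulVr; rewrite unfold_in /= /fps_unit f0 unitr1. Qed.

Lemma fps_divK (f g : fps rat) : f 0%N = 1 -> g / f * f = g.
Proof. by move=> f0; rewrite -mulrA fps_mulVr // mulr1. Qed.

Lemma fps_inv0 (f : fps rat) : f 0%N = 1 -> f^-1 0%N = 1.
Proof.
move=> f0; have := congr1 (fun u : fps rat => u 0%N) (fps_mulVr f0).
by rewrite fps_mulE0 f0 mulr1.
Qed.

Lemma fps_theta_inv (f : fps rat) :
  f 0%N = 1 -> fps_theta f^-1 = - fps_theta f * f^-1 * f^-1.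
Proof.
move=> f0; have Vf := fps_mulVr f0; have := fps_theta1 rat.
rewrite -Vf fps_thetaM; set w := f^-1 in Vf *; set v := fps_theta f.
set u := fps_theta w => uv0.
have -> : u = (u * f + w * v) * w - v * w * w + u * (1 - w * f) by ring.
by rewrite uv0 Vf; ring.
Qed.

Lemma sinhc_sqrt0 : sinhc_sqrt 0%N = 1.
Proof. by rewrite /sinhc_sqrt muln0 factS fact0 invr1. Qed.

Lemma cosh_sqrt0 : cosh_sqrt 0%N = 1.
Proof. by rewrite /cosh_sqrt muln0 fact0 invr1. Qed.

Lemma theta_sinhc_sqrt : fps_theta sinhc_sqrt *+ 2 = cosh_sqrt - sinhc_sqrt.
Proof.
apply: fps_ext => n; rewrite fps_mulrnE fps_addE fps_oppE /fps_theta.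
rewrite /sinhc_sqrt /cosh_sqrt factS natrM.
have nz : ((2 * n)`!)%:R != 0 :> rat by rewrite pnatr_eq0 -lt0n fact_gt0.
by field; rewrite nz -natrM -(natrD _ 1) pnatr_eq0.
Qed.

Lemma theta_cosh_sqrt : fps_theta cosh_sqrt *+ 2 = fps_monom 1 1 * sinhc_sqrt.
Proof.
apply: fps_ext => -[|n]; first by rewrite fps_mulrnE /fps_theta mulr0n mul0rn fps_monomM.
rewrite fps_mulrnE fps_monomM /fps_theta /sinhc_sqrt /cosh_sqrt subn1 mul1r /=.
rewrite mulnS add2n factS natrM.
have nz : ((2 * n).+1`!)%:R != 0 :> rat by rewrite pnatr_eq0 -lt0n fact_gt0.
by field; rewrite nz -?natrM -?natrD -?(natrD _ 1) ?pnatr_eq0.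
Qed.

(** This is [Q_L]; it has a name of its own because it also generates the Bernoulli
    numbers and occurs, rescaled, in the logarithmic derivatives of both genera. *)
Definition cothc_sqrt : fps rat := cosh_sqrt / sinhc_sqrt.

(** With [s = sinh (sqrt z) / sqrt z] and [c = cosh (sqrt z)], this is the quotient
    rule applied to [2 theta s = c - s] and [2 theta c = z s]. *)
Lemma cothc_sqrt_riccati : riccati 2 (fps_monom 1 1) cothc_sqrt.
Proof.
have s0 := sinhc_sqrt0; split.
  by rewrite /cothc_sqrt fps_mulE0 fps_inv0 // cosh_sqrt0 mulr1.
rewrite /cothc_sqrt fps_thetaM fps_theta_inv //.
have -> : (fps_theta cosh_sqrt / sinhc_sqrt +
    cosh_sqrt * (- fps_theta sinhc_sqrt / sinhc_sqrt / sinhc_sqrt)) *+ 2 =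
  (fps_theta cosh_sqrt *+ 2) / sinhc_sqrt -
    cosh_sqrt / sinhc_sqrt * (fps_theta sinhc_sqrt *+ 2) / sinhc_sqrt.
  set u := fps_theta cosh_sqrt; set v := fps_theta sinhc_sqrt.
  set w := sinhc_sqrt^-1; ring.
rewrite theta_cosh_sqrt theta_sinhc_sqrt.
have := fps_mulVr s0; set w := sinhc_sqrt^-1; set s := sinhc_sqrt => Vs.
set c := cosh_sqrt; set z := fps_monom 1 1.
(* The right-hand side displays the products [w * s], which are 1. *)
have -> : z * s * w - c * w * (c - s) * w =
  z * (w * s) + c * w * (w * s) - c * w * (c * w) by ring.
by rewrite Vs; ring.
Qed.

(** * Bernoulli numbers *)

(** The substitution [f (t ^ 2)]. *)
Definition fps_subst_sqr (f : fps rat) : fps rat := fun n => if odd n then 0 else f n./2.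

Lemma sum_even_terms (F : nat -> rat) n :
  (forall i, odd i -> F i = 0) ->
  \sum_(i < n.*2.+1) F i = \sum_(i < n.+1) F i.*2.
Proof.
move=> F0; elim: n => [|n IHn]; first by rewrite !big_ord1.
rewrite doubleS 2!big_ord_recr IHn /= (F0 n.*2.+1) ?addr0; last by rewrite /= odd_double.
by rewrite [RHS]big_ord_recr.
Qed.

Lemma fps_subst_sqrM f g : fps_subst_sqr (f * g) = fps_subst_sqr f * fps_subst_sqr g.
Proof.
apply: fps_ext => n; rewrite [RHS]fps_mulE {1}/fps_subst_sqr.
case: ifPn => [odd_n | even_n].
  rewrite big1 // => i _; rewrite /fps_subst_sqr.
  case: ifPn => [_|even_i]; first by rewrite mul0r.
  have le_in : (i <= n)%N by rewrite -ltnS.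
  by rewrite oddB // odd_n (negPf even_i) mulr0.
rewrite -[in RHS](even_halfK even_n).
rewrite (@sum_even_terms (fun i => fps_subst_sqr f i * fps_subst_sqr g (n./2.*2 - i)%N)); last first.
  by move=> i odd_i; rewrite /fps_subst_sqr odd_i mul0r.
rewrite fps_mulE; apply: eq_bigr => i _.
by rewrite /fps_subst_sqr -doubleB !odd_double !doubleK.
Qed.

(** The Euler derivation of [f (t ^ 2)] is twice that of [f], taken at [t ^ 2]. *)
Lemma riccati_subst_sqr m d (a : rat) f :
  riccati (m * 2) (fps_monom d a) f -> riccati m (fps_monom d.*2 a) (fps_subst_sqr f).
Proof.
move=> [f0 df]; split=> //; rewrite -fps_subst_sqrM; apply: fps_ext => n.
rewrite fps_mulrnE !fps_addE fps_oppE /fps_theta /fps_subst_sqr /fps_monom.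
have [odd_n | even_n] := boolP (odd n).
  rewrite !mul0rn subr0 add0r; case: eqP => // eq_n.
  by rewrite eq_n odd_double in odd_n.
have -> : (n == d.*2) = (n./2 == d)
  by rewrite -{1}(even_halfK even_n) (inj_eq double_inj).
move/(congr1 (fun u : fps rat => u n./2)): df.
rewrite fps_mulrnE !fps_addE fps_oppE /fps_theta /fps_monom => <-.
by rewrite -!mulrnA; congr (_ *+ _); rewrite -{1}(even_halfK even_n) -muln2; lia.
Qed.

(** t / (e^t - 1). *)
Definition bernoulli_egf : fps rat := ((fun i => (i.+1)`!%:R^-1) : fps rat)^-1.

(** [E = (e ^ t - 1) / t] satisfies [theta E = e ^ t - E = 1 + t E - E], so
    [w = 1 / E] satisfies [theta w = w - w ^ 2 - t w]; adding [t / 2] completes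
    the square and removes the term [t w]. *)
Lemma bernoulli_egf_riccati :
  riccati 1 (fps_monom 2 4^-1) (bernoulli_egf + fps_monom 1 2^-1).
Proof.
set E : fps rat := fun i => (i.+1)`!%:R^-1.
have E0 : E 0%N = 1 by rewrite /E factS fact0 invr1.
have dE : fps_theta E = 1 + fps_monom 1 1 * E - E.
  apply: fps_ext => -[|n].
    by rewrite !fps_addE fps_monomM fps_oppE E0 /fps_theta fps_oneE /=; ring.
  rewrite !fps_addE fps_monomM fps_oppE fps_oneE /fps_theta /E subn1 /= [n.+2`!]factS natrM.
  have nz : (n.+1`!)%:R != 0 :> rat by rewrite pnatr_eq0 -lt0n fact_gt0.
  by field; rewrite nz -(natrD _ 2) pnatr_eq0.
have VE := fps_mulVr E0.
rewrite /bernoulli_egf -/E; split.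
  by rewrite fps_addE fps_inv0 // addr0.
rewrite mulr1n fps_thetaD fps_theta_inv //.
have -> : fps_theta (fps_monom 1 2^-1) = fps_monom 1 2^-1 :> fps rat.
  by apply: fps_ext => -[|[|n]]; rewrite /fps_theta /fps_monom ?mulr0n ?mul0rn.
have -> : fps_monom 2 4^-1 = fps_monom 1 2^-1 * fps_monom 1 2^-1 :> fps rat.
  by rewrite fps_monom_mul; congr fps_monom; field.
have dE' : fps_theta E = 1 + (fps_monom 1 2^-1 *+ 2) * E - E.
  rewrite dE; congr (1 + _ * _ - _); apply: fps_ext => n.
  by rewrite fps_mulrnE /fps_monom; case: eqP => // _; rewrite -mulr_natr mulVf.
rewrite dE'; set w := E^-1 in VE *; set h := fps_monom 1 _.
have -> : - (1 + h *+ 2 * E - E) * w * w + h =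
  - (w * w) - h *+ 2 * (w * E) * w + (w * E) * w + h by ring.
by rewrite VE; ring.
Qed.

(** Both [t / (e ^ t - 1) + t / 2] and [V (t ^ 2 / 4)] solve
    [theta f = f - f ^ 2 + t ^ 2 / 4]. *)
Lemma bernoulli_cothc j :
  (0 < j)%N -> bernoulli (2 * j) = (2 * j)`!%:R * (4^-1 ^+ j * cothc_sqrt j).
Proof.
move=> j_gt0.
have eq_b : bernoulli_egf + fps_monom 1 2^-1 = fps_subst_sqr (fps_dilate idfun 4^-1 cothc_sqrt).
  apply: riccati_unique bernoulli_egf_riccati _.
  have -> : fps_monom 2 4^-1 = fps_monom 1.*2 4^-1 :> fps rat by [].
  apply: riccati_subst_sqr.
  have -> : fps_monom 1 4^-1 = fps_dilate idfun 4^-1 (fps_monom 1 1) :> fps rat.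
    apply: fps_ext => n; rewrite /fps_dilate /fps_monom /=.
    by case: eqP => [->|_]; rewrite ?mul1r ?mul0r.
  exact: riccati_dilate cothc_sqrt_riccati.
rewrite /bernoulli; congr (_ * _).
move/(congr1 (fun u : fps rat => u (2 * j)%N)): eq_b.
rewrite fps_addE /fps_subst_sqr mul2n odd_double doubleK /fps_dilate /= mulrC => <-.
by rewrite /fps_monom; case: eqP => [eq1|_]; rewrite ?addr0 //; lia.
Qed.

(** [u = 1 - V (- z)] satisfies [2 theta u + u = u ^ 2 + z] with [u_0 = 0], that is
    [(2 n + 1) u_n = \sum_(0 < i < n) u_i u_(n - i)], plus 1 for [n = 1].  All
    coefficients of positive degree are therefore positive. *)
Lemma cothc_sqrt_neq0 j : cothc_sqrt j.+1 != 0.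
Proof.
pose u := 1 - fps_dilate idfun (-1) cothc_sqrt.
have [V0 dV] := riccati_dilate (-1) cothc_sqrt_riccati.
have u0 : u 0%N = 0 by rewrite /u fps_addE fps_oppE V0 fps_oneE subrr.
have du : fps_theta u *+ 2 + u = u * u + fps_monom 1 1.
  rewrite /u fps_thetaD fps_thetaN fps_theta1 add0r mulNrn dV.
  have -> : fps_dilate idfun (-1) (fps_monom 1 1) = - fps_monom 1 1 :> fps rat.
    apply: fps_ext => n; rewrite /fps_dilate fps_oppE /fps_monom /=.
    by case: eqP => [->|_]; rewrite ?mul1r ?mul0r ?oppr0.
  ring.
have u_gt0 n : 0 < u n.+1.
  elim/ltn_ind: n => n IHn.
  have u_ge0 i : (i < n.+1)%N -> 0 <= u i.
    by case: i => [|i]; rewrite ?u0 // ltnS => /IHn/ltW.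
  have : 0 < (fps_theta u *+ 2 + u) n.+1.
    rewrite du fps_addE fps_mulE big_ord_recl big_ord_recr /= u0 mul0r add0r.
    rewrite /bump /= add1n subnn u0 mulr0 addr0.
    case: n IHn u_ge0 => [|n] IHn u_ge0; first by rewrite big_ord0 add0r.
    rewrite addr0 big_ord_recl /= /bump /= addn0 subn1 ltr_wpDr ?mulr_gt0 ?IHn //.
    apply: sumr_ge0 => i _; apply: mulr_ge0; apply: u_ge0; have := ltn_ord i; lia.
  by rewrite fps_addE fps_mulrnE /fps_theta -mulrnA -mulrSr pmulrn_lgt0.
apply/eqP => V_eq0; have := u_gt0 j.
by rewrite /u fps_addE fps_oppE fps_oneE /fps_dilate V_eq0 mul0r subrr ltxx.
Qed.

(** * Logarithmic derivatives of the characteristic series *)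

(** Here [Q = 1 / s] with [s = sinh (sqrt z / 2) / (sqrt z / 2)], hence
    [l = - theta s / s]. *)
Lemma Q_Ahat_theta : exists2 l : fps rat,
  fps_theta Q_Ahat = Q_Ahat * l & l *+ 2 = 1 - fps_dilate idfun 4^-1 cothc_sqrt.
Proof.
pose s := fps_dilate idfun 4^-1 sinhc_sqrt.
have s_half : sinhc_half_sqrt = s by apply: fps_ext => n; rewrite /s /fps_dilate mulrC.
have s0 : s 0%N = 1 by rewrite /s /fps_dilate sinhc_sqrt0 /= mulr1.
have ds : fps_theta s *+ 2 = fps_dilate idfun 4^-1 cothc_sqrt * s - s.
  rewrite -[_ * s]fps_dilateM /cothc_sqrt fps_divK ?sinhc_sqrt0 //.
  rewrite -fps_dilateN -fps_dilateD -theta_sinhc_sqrt fps_dilate_theta.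
  by apply: fps_ext => n; rewrite fps_mulrnE /fps_dilate /= fps_mulrnE /fps_theta !mulrnAl.
have Vs := fps_mulVr s0; rewrite /Q_Ahat s_half.
exists (- fps_theta s / s); first by rewrite fps_theta_inv //; ring.
rewrite -mulrnAl mulNrn ds; set w := s^-1 in Vs *; set D := fps_dilate _ _ _.
have -> : - (D * s - s) * w = w * s - D * (w * s) by ring.
by rewrite Vs mulr1.
Qed.

(** The Riccati equation divided by [V] gives [2 l = 1 - V + z / V], and
    [z / V = sqrt z tanh (sqrt z)].  The coefficients of the latter come from
    [T = V + z / V]: as the product of the two summands is [z], adding their
    Riccati equations gives [2 theta T = T - T ^ 2 + 4 z]. *)
Lemma Q_L_theta : exists2 l : fps rat,
  fps_theta Q_L = Q_L * l & l *+ 2 = 1 - cothc_sqrt *+ 2 + fps_dilate idfun 4 cothc_sqrt.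
Proof.
have [V0 dV] := cothc_sqrt_riccati; set V := cothc_sqrt in V0 dV *.
have VV := fps_mulVr V0; set w := V^-1 in VV; pose z : fps rat := fps_monom 1 1.
pose T := V + z * w.
have T_dilate : T = fps_dilate idfun 4 V.
  apply: riccati_unique (riccati_dilate 4 cothc_sqrt_riccati).
  split; first by rewrite /T fps_addE fps_monomM V0 addr0.
  have -> : fps_dilate idfun 4 (fps_monom 1 1) = z *+ 4 :> fps rat.
    apply: fps_ext => n; rewrite /fps_dilate fps_mulrnE /z /fps_monom /=.
    by case: eqP => [->|_]; rewrite ?mul1r ?mul0r ?mul0rn.
  have dz : fps_theta z = z.
    by apply: fps_ext => -[|[|n]]; rewrite /fps_theta /z /fps_monom ?mulr0n ?mul0rn.
  rewrite /T fps_thetaD [fps_theta (z * w)]fps_thetaM dz fps_theta_inv // -/w.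
  have -> : (fps_theta V + (z * w + z * (- fps_theta V * w * w))) *+ 2 =
    (fps_theta V *+ 2) * (1 - z * w * w) + z * w *+ 2 by ring.
  rewrite dV -/z.
  (* Both sides are rearranged so as to display the products [w * V], which are 1. *)
  have -> : (V - V * V + z) * (1 - z * w * w) + z * w *+ 2 =
    V + z * w *+ 2 - V * V - z * w * (w * V) + z * (w * V) * (w * V) + z
      - (z * w) * (z * w) by ring.
  have -> : V + z * w - (V + z * w) * (V + z * w) + z *+ 4 =
    V + z * w - V * V - z * (w * V) *+ 2 - (z * w) * (z * w) + z *+ 4 by ring.
  by rewrite VV; ring.
exists (w * fps_theta V); first by rewrite -[Q_L]/V mulrA (mulrC V) VV mul1r.
rewrite -T_dilate -mulrnAr dV -/z /T.
have -> : w * (V - V * V + z) = w * V - (w * V) * V + z * w by ring.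
by rewrite VV; ring.
Qed.

(** * Exponential formula over partitions *)

Section Exponential.
Variable A : comAlgType rat.
Implicit Types (f g l : fps A) (a : nat -> A).

(** The equation [theta f = f l] expresses [n f_n] through lower coefficients.
    Agreement is only asked up to degree [k], because the exponential will be
    truncated to the parts [j <= k]. *)
Lemma fps_theta_unique k f g l h :
  f 0%N = g 0%N -> l 0%N = 0 ->
  fps_theta f = f * l -> fps_theta g = g * h -> fps_agree k l h -> fps_agree k f g.
Proof.
move=> fg0 l0 df dg lh; elim/ltn_ind => -[|n] IHn // le_nk.
have /(congr1 (fun x => n.+1%:R^-1 *: x)) : f n.+1 *+ n.+1 = g n.+1 *+ n.+1.
  rewrite -[LHS]/(fps_theta f n.+1) -[RHS]/(fps_theta g n.+1) df dg !fps_mulE.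
  apply: eq_bigr => i _; rewrite -lh ?(leq_trans (leq_subr _ _)) //.
  case: (ltngtP i n.+1) => [lt_in|gt_in|->].
  - by rewrite IHn // (leq_trans (ltnW lt_in)).
  - by have := ltn_ord i; rewrite ltnS leqNgt gt_in.
  - by rewrite subnn l0 !mulr0.
by rewrite -!scaler_nat !scalerA mulVf ?pnatr_eq0 // !scale1r.
Qed.

(** exp (a t^j). *)
Definition fps_exp_monom (j : nat) (a : A) : fps A :=
  fun n => if (j %| n)%N then (n %/ j)`!%:R^-1 *: a ^+ (n %/ j) else 0.

Lemma fps_theta_exp_monom j (a : A) : (0 < j)%N ->
  fps_theta (fps_exp_monom j a) = fps_exp_monom j a * fps_monom j (a *+ j).
Proof.
move=> j_gt0; apply: fps_ext => n; rewrite mulrC fps_monomM /fps_theta /fps_exp_monom.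
have [/dvdnP[m ->] | ndvd] := boolP (j %| n)%N; last first.
  rewrite mul0rn; case: leqP => // le_jn.
  by rewrite -(@dvdn_addl j j (n - j)) ?subnK ?(negPf ndvd) ?mulr0.
rewrite mulnK //; case: m => [|m]; first by rewrite mulr0n leqNgt j_gt0.
rewrite leq_pmull // mulSn addKn dvdn_mull // mulnK // -mulSn.
rewrite factS exprS -scalerAr mulrnAl -!scaler_nat !scalerA; congr (_ *: _).
have nz : m`!%:R != 0 :> rat by rewrite pnatr_eq0 -lt0n fact_gt0.
by rewrite !natrM; field; rewrite nz -(natrD _ 1) pnatr_eq0.
Qed.

Lemma fps_exp_monom_agree k j (a : A) : (0 < j)%N ->
  fps_agree k (fps_exp_monom j a)
    (\sum_(m < k.+1) fps_monom (j * m) (m`!%:R^-1 *: a ^+ m)).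
Proof.
move=> j_gt0 n le_nk; rewrite fps_sumE /fps_exp_monom /fps_monom.
have [/dvdnP[m eq_n] | ndvd] := boolP (j %| n)%N; last first.
  rewrite big1 // => m _; case: eqP => // eq_n.
  by rewrite eq_n dvdn_mulr in ndvd.
have lt_mk : (m < k.+1)%N by rewrite ltnS (leq_trans _ le_nk) // eq_n leq_pmulr.
rewrite eq_n mulnK // (bigD1 (Ordinal lt_mk)) //= mulnC eqxx big1 ?addr0 // => i.
by rewrite -val_eqE /= eqn_pmul2l // eq_sym => /negPf->.
Qed.

(** Expanding the product of the exponential series, one summand is chosen from
    each factor; the choices of total degree [k] are the multiplicity functions
    of the partitions of [k].  A multiplicity above [k] gives a degree above [k],
    so every factor may be truncated. *)
Lemma fps_exp_coef k a :
  (\prod_(j < k) fps_exp_monom j.+1 (a j.+1)) k =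
  \sum_(l : mpart k) \prod_(j < k) ((mult l j)`!%:R^-1 *: a j.+1 ^+ mult l j).
Proof.
rewrite (@fps_agree_prod _ k _ _ (fun j : 'I_k => \sum_(m < k.+1)
  fps_monom (j.+1 * m) (m`!%:R^-1 *: a j.+1 ^+ m))) //; last first.
  by move=> j; apply: fps_exp_monom_agree.
rewrite bigA_distr_bigA fps_sumE /=.
under eq_bigr do rewrite fps_monom_prod /fps_monom eq_sym.
rewrite -big_mkcond /=.
exact: (big_sub (fun m : {ffun 'I_k -> 'I_k.+1} => _)).
Qed.

Lemma fps_exp_unique k f l a :
  f 0%N = 1 -> l 0%N = 0 -> fps_theta f = f * l ->
  (forall j, l j.+1 = a j.+1 *+ j.+1) ->
  f k = \sum_(l : mpart k) \prod_(j < k) ((mult l j)`!%:R^-1 *: a j.+1 ^+ mult l j).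
Proof.
move=> f0 l0 df la; rewrite -fps_exp_coef.
have dprod := fps_theta_prod (index_enum 'I_k)
  (fun j : 'I_k => fps_theta_exp_monom (a j.+1) (ltn0Sn j)).
apply: (fps_theta_unique (k := k) _ l0 df dprod) => //.
  rewrite f0 fps_prodE0 big1 // => j _.
  by rewrite /fps_exp_monom dvdn0 div0n fact0 invr1 scale1r.
move=> [|n] le_nk; rewrite fps_sumE /fps_monom; first by rewrite big1.
rewrite (bigD1 (Ordinal le_nk)) //= eqxx big1 ?addr0 // => i.
by rewrite -val_eqE /= eqSS eq_sym => /negPf->.
Qed.

End Exponential.

(** * Expansion of a genus in power sums *)

(** The logarithmic derivative of [\prod_i Q (x_i t)] is [\sum_i l (x_i t)], with
    coefficients [l_j s_j]. *)
Lemma genus_expansion (Q l : fps rat) n k :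
  Q 0%N = 1 -> fps_theta Q = Q * l ->
  genus Q n k = \sum_(lam : mpart k)
    (\prod_(j < k) ((mult lam j)`!%:R^-1 * (l j.+1 / j.+1%:R) ^+ mult lam j)) *:
      partition_monomial (power_sum n) lam.
Proof.
move=> Q0 dQ.
pose iota : {rmorphism rat -> mpoly n rat} := in_alg (mpoly n rat).
pose dil x := fps_dilate iota (mpolyX rat (mnm1 x)).
have genusE : genus Q n = \prod_(i < n) dil i Q.
  apply: eq_bigr => i _; apply: fps_ext => j.
  by rewrite /dil /fps_dilate /= mulr_algl.
have dil_theta i : fps_theta (dil i Q) = dil i Q * dil i l.
  by rewrite fps_dilate_theta dQ fps_dilateM.
have l0 : l 0%N = 0.
  by have := congr1 (fun u : fps rat => u 0%N) dQ; rewrite fps_mulE0 Q0 mul1r.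
rewrite genusE.
rewrite (fps_exp_unique k (l := \sum_(i < n) dil i l)
  (a := fun j => (l j / j%:R) *: power_sum n j)).
- apply: eq_bigr => lam _; rewrite /partition_monomial -scaler_prod.
  by apply: eq_bigr => j _; rewrite exprZn scalerA.
- by rewrite fps_prodE0 big1 // => i _; rewrite /dil /fps_dilate Q0 rmorph1 mulr1.
- by rewrite fps_sumE big1 // => i _; rewrite /dil /fps_dilate l0 rmorph0 mul0r.
- exact: fps_theta_prod.
move=> j; rewrite fps_sumE -scaler_nat scalerA mulrC divfK ?pnatr_eq0 //.
rewrite /power_sum scaler_sumr; apply: eq_bigr => i _.
by rewrite /dil /fps_dilate /= mulr_algl.
Qed.

(** * Linear independence of the power sum products *)

Lemma poly_nat_roots (p : {poly rat}) : (forall N : nat, p.[N%:R] = 0) -> p = 0.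
Proof.
move=> p_nat; apply/eqP/negPn/negP => p_neq0.
pose rs : seq rat := [seq N%:R | N <- iota 0 (size p)].
have := @max_poly_roots _ p rs p_neq0; rewrite size_map size_iota ltnn => contra.
suff: false by []; apply: contra.
  by apply/allP => _ /mapP[N _ ->]; apply/rootP.
by rewrite map_inj_uniq ?iota_uniq // => x y /eqP; rewrite eqr_nat => /eqP.
Qed.

Lemma digits_inj B n (a b : 'I_n -> nat) :
  (forall j, (a j < B)%N) -> (forall j, (b j < B)%N) ->
  (\sum_(j < n) a j * B ^ j = \sum_(j < n) b j * B ^ j)%N -> a =1 b.
Proof.
move=> + + + j; elim: n a b j => [|n IHn] a b; first by case.
move=> j a_lt b_lt; rewrite !big_ord_recl !expn0 !muln1.
have shift (c : 'I_n.+1 -> nat) : (\sum_(i < n) c (lift ord0 i) * B ^ lift ord0 i =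
    (\sum_(i < n) c (lift ord0 i) * B ^ i) * B)%N.
  by rewrite big_distrl /=; apply: eq_bigr => i _; rewrite -mulnA -expnSr.
rewrite !shift => eq_ab.
have B_gt0 : (0 < B)%N by apply: leq_ltn_trans (a_lt ord0).
have eq0 : a ord0 = b ord0.
  move/(congr1 (modn^~ B)): (eq_ab).
  by rewrite /= ![(_ ord0 + _)%N]addnC !modnMDl !modn_small.
case: (unliftP ord0 j) => [i ->|-> //]; apply: (IHn (a \o lift ord0) (b \o lift ord0)).
- by move=> h; apply: a_lt.
- by move=> h; apply: b_lt.
by move/eqP: eq_ab; rewrite eq0 eqn_add2l eqn_pmul2r // => /eqP.
Qed.

Definition partition_poly k (beta : mpart k -> rat) (y : nat -> rat) : rat :=
  \sum_(l : mpart k) beta l * partition_monomial y l.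

(** A polynomial that vanishes on the power sums of all finite rational alphabets
    vanishes identically: these points contain all combinations
    [\sum_i N_i (a_i, a_i ^ 2, ..., a_i ^ k)] with [N_i] natural (repeat the letter
    [a_i = i + 1] exactly [N_i] times), natural weights may be replaced by rational
    ones one at a time, and by Vandermonde the combinations then fill the space. *)
Section PowerSums.
Variables (k : nat) (beta : mpart k -> rat).

Hypothesis poly_alphabet : forall s : seq rat,
  partition_poly beta (fun j => \sum_(x <- s) x ^+ j) = 0.

Lemma weighted_alphabet_nat (N : 'I_k -> nat) :
  partition_poly beta (fun j => \sum_(i < k) (N i)%:R * i.+1%:R ^+ j) = 0.
Proof.
rewrite -[RHS](poly_alphabet (flatten [seq nseq (N i) i.+1%:R | i <- index_enum 'I_k])).
congr (partition_poly _ _); apply/funext => j; rewrite big_flatten big_map.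
by apply: eq_bigr => i _; rewrite big_nseq iter_addr_0 mulr_natl.
Qed.

Lemma weighted_alphabet (t : 'I_k -> rat) :
  partition_poly beta (fun j => \sum_(i < k) t i * i.+1%:R ^+ j) = 0.
Proof.
(* The weights of index below [r] are arbitrary, the others natural. *)
suff claim r : (r <= k)%N -> forall t : 'I_k -> rat,
    (forall i : 'I_k, (r <= i)%N -> exists N : nat, t i = N%:R) ->
    partition_poly beta (fun j => \sum_(i < k) t i * i.+1%:R ^+ j) = 0.
  by apply: (claim k) => // i; rewrite leqNgt ltn_ord.
elim: r => [_ {}t t_nat|r IHr lt_rk {}t t_nat].
  have [N tN] : exists N : 'I_k -> nat, forall i, t i = (N i)%:R.
    exact: (fin_all_exists (fun i => t_nat i (leq0n i))).
  rewrite -[RHS](weighted_alphabet_nat N); congr (partition_poly _ _).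
  by apply/funext => j; apply: eq_bigr => i _; rewrite tN.
pose r0 := Ordinal lt_rk.
(* The weight at [r0] becomes the indeterminate. *)
pose p : {poly rat} := \sum_(l : mpart k) beta l *:
  partition_monomial (fun j => (\sum_(i < k | i != r0) t i * i.+1%:R ^+ j)%:P
                               + r0.+1%:R ^+ j *: 'X) l.
have p_eval c : p.[c] = partition_poly beta
    (fun j => \sum_(i < k) (if i == r0 then c else t i) * i.+1%:R ^+ j).
  rewrite /p horner_sum /partition_poly; apply: eq_bigr => l _.
  rewrite hornerZ; congr (_ * _); rewrite /partition_monomial horner_prod; apply: eq_bigr => j _.
  rewrite horner_exp hornerD hornerC hornerZ hornerX; congr (_ ^+ _).
  rewrite [RHS](bigD1 r0) //= eqxx addrC mulrC; congr (_ + _).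
  by apply: eq_bigr => i /negPf->.
have p0 : p = 0.
  apply: poly_nat_roots => N; rewrite p_eval; apply: IHr => [|i]; first exact: ltnW.
  case: eqP => [_ _|/eqP ne_ir le_ri]; first by exists N.
  by apply: t_nat; rewrite ltn_neqAle le_ri eq_sym -val_eqE in ne_ir *; rewrite ne_ir.
have := p_eval (t r0); rewrite p0 horner0 => f0; rewrite [RHS]f0.
by congr (partition_poly _ _); apply/funext => j; apply: eq_bigr => i _; case: eqP => [->|].
Qed.

Lemma power_sums_arbitrary (y : nat -> rat) : partition_poly beta y = 0.
Proof.
pose V : 'M[rat]_k := \matrix_(i, j) i.+1%:R ^+ j.+1.
have V_unit : V \in unitmx.
  have -> : V = diag_mx (\row_i i.+1%:R) *m (Vandermonde k (\row_i i.+1%:R))^T.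
    by apply/matrixP => i j; rewrite mul_diag_mx !mxE exprS.
  rewrite unitmx_mul !unitmxE det_diag det_tr det_Vandermonde !unitfE.
  apply/andP; split; apply/prodf_neq0 => i _; first by rewrite mxE pnatr_eq0.
  apply/prodf_neq0 => j lt_ij; rewrite !mxE subr_eq0 eqr_nat eqSS.
  by rewrite neq_ltn lt_ij orbT.
pose t : 'rV[rat]_k := (\row_j y j.+1) *m invmx V.
rewrite -[RHS](weighted_alphabet (t 0)); apply: eq_bigr => l _; congr (_ * _).
apply: eq_bigr => j _; congr (_ ^+ _).
have /matrixP/(_ 0 j) : t *m V = \row_j y j.+1 by rewrite mulmxKV.
by rewrite mxE [RHS]mxE => <-; apply: eq_bigr => i _; rewrite [V _ _]mxE.
Qed.

(** Kronecker substitution: at [y_j = X ^ ((k + 1) ^ (j - 1))] distinct monomials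
    become distinct powers of [X], since multiplicities are digits in base
    [k + 1]. *)
Lemma power_sum_coef0 l : beta l = 0.
Proof.
pose code (m : mpart k) := (\sum_(j < k) mult m j * k.+1 ^ j)%N.
have code_inj : injective code.
  move=> m m' eq_code; apply/val_inj/ffunP => j; apply/val_inj.
  by apply: (digits_inj _ _ eq_code) => i; apply: ltn_ord.
pose p : {poly rat} := \sum_(m : mpart k) beta m *: 'X^(code m).
have p0 : p = 0.
  apply: poly_nat_roots => N.
  rewrite -[RHS](power_sums_arbitrary (fun j => N%:R ^+ (k.+1 ^ j.-1))).
  rewrite /p horner_sum /partition_poly; apply: eq_bigr => m _.
  rewrite hornerZ hornerXn; congr (_ * _).
  by rewrite /code expr_sum; apply: eq_bigr => j _ /=; rewrite -exprM mulnC.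
have := coef0 rat (code l); rewrite -p0 coef_sum (bigD1 l) //= coefZ coefXn eqxx mulr1.
rewrite big1 ?addr0 // => m ne_ml; rewrite coefZ coefXn.
by rewrite (inj_eq code_inj) eq_sym (negPf ne_ml) mulr0.
Qed.

End PowerSums.

Lemma power_sum_partitions_free k (beta gamma : {ffun mpart k -> rat}) :
  (forall n, \sum_(l : mpart k) beta l *: partition_monomial (power_sum n) l =
             \sum_(l : mpart k) gamma l *: partition_monomial (power_sum n) l) ->
  beta = gamma.
Proof.
move=> eq_bg; apply/ffunP => l; apply/eqP; rewrite -subr_eq0; apply/eqP.
apply: (power_sum_coef0 (beta := fun l => beta l - gamma l)) => s.
pose v (i : 'I_(size s)) := s`_i.
have ev (b : mpart k -> rat) :
    meval v (\sum_(l : mpart k) b l *: partition_monomial (power_sum (size s)) l) =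
    \sum_(l : mpart k) b l * partition_monomial (fun j => \sum_(x <- s) x ^+ j) l.
  rewrite rmorph_sum; apply: eq_bigr => m _; rewrite [LHS]mevalZ; congr (_ * _).
  rewrite rmorph_prod; apply: eq_bigr => j _; rewrite rmorphXn; congr (_ ^+ _).
  rewrite rmorph_sum (big_nth 0) big_mkord; apply: eq_bigr => i _.
  by rewrite rmorphXn /= mevalXU.
rewrite /partition_poly; under eq_bigr do rewrite mulrBl.
by rewrite sumrB -!ev eq_bg subrr.
Qed.

(** * Coefficients of the quasimodular avatars *)

Lemma genus_coefE (Q l : fps rat) k :
  Q 0%N = 1 -> fps_theta Q = Q * l ->
  genus_coef Q k = [ffun lam : mpart k =>
    \prod_(j < k) ((mult lam j)`!%:R^-1 * (l j.+1 / j.+1%:R) ^+ mult lam j)].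
Proof.
move=> Q0 dQ; apply: xget_unique => [n|gamma gammaP].
  by rewrite (genus_expansion n k Q0 dQ); apply: eq_bigr => lam _; rewrite ffunE.
apply: power_sum_partitions_free => n; rewrite -gammaP (genus_expansion n k Q0 dQ).
by apply: eq_bigr => lam _; rewrite ffunE.
Qed.

(** The Bernoulli number contained in [l_j] by [bernoulli_cothc] cancels the one in
    the normalisation, and only the factor [c_j / (2j)!] is left. *)
Lemma genus_coef_starE (Q l : fps rat) (c : nat -> rat) k (lam : mpart k) :
  Q 0%N = 1 -> fps_theta Q = Q * l ->
  (forall j, (0 < j)%N -> l j *+ 2 = c j * (4^-1 ^+ j * cothc_sqrt j)) ->
  genus_coef_star Q lam =
  \prod_(j < k) ((mult lam j)`!%:R^-1 * (c j.+1 / (2 * j.+1)`!%:R) ^+ mult lam j).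
Proof.
move=> Q0 dQ lc; rewrite /genus_coef_star (genus_coefE k Q0 dQ) ffunE -big_split.
apply: eq_bigr => j _ /=; rewrite -mulrA -exprMn; congr (_ * _ ^+ _).
have nz : (2 * j.+1)`!%:R != 0 :> rat by rewrite pnatr_eq0 -lt0n fact_gt0.
have B_neq0 : bernoulli (2 * j.+1) != 0.
  by rewrite bernoulli_cothc // !mulf_neq0 ?cothc_sqrt_neq0 ?expf_neq0.
have -> : l j.+1 = c j.+1 / 2 * (bernoulli (2 * j.+1) / (2 * j.+1)`!%:R).
  rewrite bernoulli_cothc // [_`!%:R * _]mulrC mulfK // mulrAC -lc // -[l _ *+ 2]mulr_natr.
  by rewrite mulfK.
by rewrite natrM; field; rewrite nz B_neq0 -(natrD _ 1) pnatr_eq0.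
Qed.

Lemma genus_coef_star_Ahat k : @genus_coef_star Q_Ahat k =1 @phi_Ahat k.
Proof.
move=> lam; have [l dQ l2] := Q_Ahat_theta.
have Q0 : Q_Ahat 0%N = 1.
  by rewrite /Q_Ahat fps_inv0 // /sinhc_half_sqrt sinhc_sqrt0 mulr1.
apply: (genus_coef_starE (c := fun=> -1)) Q0 dQ _ => -[//|j] _.
rewrite -fps_mulrnE l2 fps_addE fps_oppE fps_oneE /fps_dilate /=; ring.
Qed.

(** [16 ^ j - 2 * 4 ^ j = 4 ^ j (4 ^ j - 2)] after the change of scale between [V_j] and
    [B_(2j) / (2j)!]. *)
Lemma genus_coef_star_L k : @genus_coef_star Q_L k =1 @phi_L k.
Proof.
move=> lam; have [l dQ l2] := Q_L_theta.
have Q0 : Q_L 0%N = 1 by case: cothc_sqrt_riccati.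
apply: (genus_coef_starE (c := fun j => 4 ^+ j * (4 ^+ j - 2))) Q0 dQ _ => -[//|j] _.
rewrite -fps_mulrnE l2 !fps_addE fps_oppE fps_mulrnE fps_oneE /fps_dilate /= exprVn.
have nz : 4 ^+ j.+1 != 0 :> rat by rewrite expf_neq0.
by field.
Qed.

Theorem theorem1p4 (R : realType) (k : nat) (hk : (0 < k)%N) :
  (avatar Q_Ahat eisenstein_fourier k
     = partition_trace eisenstein_fourier (@phi_Ahat k) /\
   avatar Q_L eisenstein_fourier k
     = partition_trace eisenstein_fourier (@phi_L k)) /\
  (forall tau : R[i], 0 < complex.Im tau ->
   avatar Q_Ahat (eisenstein tau) k
     = partition_trace (eisenstein tau) (@phi_Ahat k) /\
   avatar Q_L (eisenstein tau) k
     = partition_trace (eisenstein tau) (@phi_L k)).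
Proof.
have eq_trace (A : comUnitRingType) (g : nat -> A) :
    avatar Q_Ahat g k = partition_trace g (@phi_Ahat k) /\
    avatar Q_L g k = partition_trace g (@phi_L k).
  by split; apply: eq_bigr => lam _; rewrite ?genus_coef_star_Ahat ?genus_coef_star_L.
by split=> [|tau _]; apply: eq_trace.
Qed.
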